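(* Let $a\neq 0$ be a fixed integer. For an integer $m\geqslant 1$ let $$\mathcal K_m(a)=\frac{1}{\sqrt m}\sum_{x\in\mathbb Z_m^*}\exp\!\Big(\frac{2\pi i(ax+\overline x)}{m}\Big),\qquad \mathcal K_m^*(a)=\frac{|\mathcal K_m(a)|}{2^{\omega(m)}},$$ where $\overline x$ is the inverse of $x$ modulo $m$ and $\omega(m)$ is the number of distinct prime factors of $m$. Put $\overline{\mathsf H}^*_a(M)=\sum_{m=1}^M|\mathcal K_m^*(a)|$ and, for $\xi:\mathbb N\to\mathbb C$, $\mathsf H^*_{a,\xi}(M)=\sum_{m=1}^M\xi(m)\mathcal K_m^*(a)$. Assume the following hypothesis (a Chowla-type conjecture for $\mathcal K^*$): there is a constant $A\geqslant 1$ depending only on $a$ such that for all fixed positive integers $\nu_1,\dots,\nu_s$ and all fixed integers $h_s>\dots>h_1\geqslant 0$, as $M\to\infty$: (i) if $\nu_1,\dots,\nu_s$ are not all even, then $$\Big|\frac1M\sum_{m=1}^M\mathcal K^*_{m+h_1}(a)^{\nu_1}\cdots\mathcal K^*_{m+h_s}(a)^{\nu_s}\Big|=o\Big(\Big(\frac{\overline{\mathsf H}^*_a(M)}{M}\Big)^{\nu_1+\dots+\nu_s}\Big);$$ (ii) if $\nu_1,\dots,\nu_s$ are all even, then (for all sufficiently large $M$) $$\Big|\frac1M\sum_{m=1}^M\mathcal K^*_{m+h_1}(a)^{\nu_1}\cdots\mathcal K^*_{m+h_s}(a)^{\nu_s}\Big|\leqslant\Big(A\frac{\overline{\mathsf H}^*_a(M)}{M}\Big)^{\nu_1+\dots+\nu_s}.$$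 Then for every deterministic function $\xi:\mathbb N\to\mathbb C$ we have $\mathsf H^*_{a,\xi}(M)=o\big(\overline{\mathsf H}^*_a(M)\big)$ as $M\to\infty$.
   Context: A dynamical system $(\mathcal X,T)$ consists of a compact metric space $(\mathcal X,d)$ and a homeomorphism $T:\mathcal X\to\mathcal X$. For $n\geqslant1$ let $d_n(x,y)=\max_{0\leqslant k\leqslant n-1}d(T^kx,T^ky)$. A set $\mathcal S\subseteq\mathcal X$ is $(n,\varepsilon)$-separated if $d_n(x,y)\geqslant\varepsilon$ for all distinct $x,y\in\mathcal S$; let $s(n,\varepsilon)$ be the largest cardinality of such a set. The topological entropy is $h_{\mathrm{top}}(T)=\lim_{\varepsilon\to0}\limsup_{n\to\infty}\frac1n\log s(n,\varepsilon)$. A function $\xi:\mathbb N\to\mathbb C$ is deterministic if there exist a dynamical system $(\mathcal X,T)$ with $h_{\mathrm{top}}(T)=0$, a continuous $f:\mathcal X\to\mathbb C$ and a point $x\in\mathcal X$ with $\xi(n)=f(T^nx)$ for all $n\in\mathbb N$.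
   Formalization: With K*_m = |K_m|/2^ω(m) as printed, hypothesis (i) fails for s=1, ν_1=1, h_1=0, so the printed theorem is vacuous; the formal theorem states it as printed and also, with the same hypothesis and conclusion, for the signed K*_m = K_m/2^ω(m). *)

(* Defs.v *)
From mathcomp Require Import all_boot all_order all_algebra.
From mathcomp Require Import finmap.
From mathcomp Require Import all_classical all_reals all_analysis.
From mathcomp Require Import complex.

Set Implicit Arguments.
Unset Strict Implicit.
Unset Printing Implicit Defensive.

Import Order.TTheory GRing.Theory Num.Theory.
Import numFieldNormedType.Exports.

Local Open Scope classical_set_scope.
Local Open Scope ring_scope.
Local Open Scope complex_scope.

Section Entropy.
Context {R : realType} {X : metricType R}.
Variable T : X -> X.

Definition homeomorphism : Prop :=
  continuous T /\ exists S : X -> X, [/\ cancel T S, cancel S T & continuous S].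

Definition bowen_dist (n : nat) (x y : X) : R :=
  \big[Num.max/0]_(k < n) mdist (iter k T x) (iter k T y).

Definition separated (n : nat) (e : R) (S : {fset X}) : Prop :=
  forall x y, x \in S -> y \in S -> x != y -> e <= bowen_dist n x y.

Definition sep_card (n : nat) (e : R) : \bar R :=
  ereal_sup [set (#|` S|%:R)%:E | S in separated n e].

Definition entropy_at (e : R) : \bar R :=
  limn_esup (fun n => ((n%:R)^-1%:E * lne (sep_card n e))%E).

(* [entropy_at] is nonincreasing in [e], so this limit always exists. *)
Definition top_entropy : \bar R := lim (entropy_at e @[e --> 0^'+]).

End Entropy.

(* The natural numbers index from 1, as do all the sums below: [xi 0] is
   unconstrained. *)
Definition deterministic (R : realType) (xi : nat -> R[i]) : Prop :=
  exists (X : metricType R) (T : X -> X) (f : X -> R[i]^o) (x : X),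
    [/\ compact [set: X], homeomorphism T, top_entropy T = 0%E, continuous f
      & forall n, (0 < n)%N -> xi n = f (iter n T x)].

Section Kloosterman.
Variable R : realType.

(* |z| as an element of R (the library's `|z| lives in R[i]). *)
Definition cabs (z : R[i]) : R := Normc.normc z.

Definition e2pi (t : R) : R[i] := cos (2 * pi * t) +i* sin (2 * pi * t).

(* The default [x] is never used when [x] is coprime to [m]; for [m = 1] both
   [x] and its inverse are 0. *)
Definition inv_mod (m : nat) (x : 'I_m) : 'I_m :=
  odflt x [pick y : 'I_m | x * y == 1 %[mod m]]%N.

Definition kloosterman (a : int) (m : nat) : R[i] :=
  (Num.sqrt m%:R)^-1%:C *
  \sum_(x < m | coprime x m) e2pi ((a%:~R * x%:R + (inv_mod x)%:R) / m%:R).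

Definition omega (m : nat) : nat := size (primes m).

Definition kloosterman_star (a : int) (m : nat) : R[i] :=
  (cabs (kloosterman a m) / 2 ^+ omega m)%:C.

(* [kloosterman a m] is real. With [kloosterman_star], which is nonnegative,
   clause (i) of [chowla_type] already fails for s = 1 and nu = 1, so that
   [chowla_type] is only meaningful for the signed normalisation below. *)
Definition kloosterman_signed_star (a : int) (m : nat) : R[i] :=
  kloosterman a m / 2 ^+ omega m.

End Kloosterman.

Section Sums.
Variable R : realType.
Implicit Types (K xi : nat -> R[i]) (M : nat).

Definition abs_sum K M : R := \sum_(1 <= m < M.+1) cabs (K m).

Definition twisted_sum xi K M : R[i] := \sum_(1 <= m < M.+1) xi m * K m.

Definition correlation K s (nu h : 'I_s -> nat) M : R[i] :=
  M%:R^-1 * \sum_(1 <= m < M.+1) \prod_(i < s) K (m + h i)%N ^+ nu i.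

(* Clause (i), some exponent odd, then clause (ii), all exponents even. *)
Definition chowla_type K : Prop :=
  exists A : R, 1 <= A /\
  forall (s : nat) (nu h : 'I_s -> nat),
    (0 < s)%N ->
    (forall i, 0 < nu i)%N ->
    (forall i j : 'I_s, i < j -> h i < h j)%N ->
    let N := (\sum_(i < s) nu i)%N in
    (~ (forall i, ~~ odd (nu i)) ->
       (fun M => cabs (correlation K nu h M))
         =o_\oo (fun M => (abs_sum K M / M%:R) ^+ N)) /\
    ((forall i, ~~ odd (nu i)) ->
       \forall M \near \oo,
         cabs (correlation K nu h M) <= (A * (abs_sum K M / M%:R)) ^+ N).

End Sums.

(* Main.v *)
Require Import Defs.
From mathcomp Require Import all_boot all_order all_algebra.
From mathcomp Require Import finmap.
From mathcomp Require Import all_classical all_reals all_analysis.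
From mathcomp Require Import complex.
From mathcomp Require Import zify lra ring.

Set Implicit Arguments.
Unset Strict Implicit.
Unset Printing Implicit Defensive.

Import Order.TTheory GRing.Theory Num.Theory.
Import numFieldNormedType.Exports.
Local Open Scope classical_set_scope.
Local Open Scope ring_scope.
Local Open Scope complex_scope.

(** Both normalisations are real sequences [kappa], and for such sequences the
    argument is Tao's derivation of Sarnak's conjecture from Chowla's.  Write
    [delta] for the mean of [|kappa|] up to [M].  For fixed bounded weights [c_h]
    expand the [2k]-th moment over [m <= M] of [sum_(h < L) c_h kappa(m + h)]: by
    the hypothesis only the words in which every shift occurs an even number of
    times contribute, and there are at most [(2 k L)^k] of them, so the moment is
    [O((2 k L)^k (A delta)^(2k))]. With [L = c k] and [c] large this is at most
    [4^(-k) (theta L delta)^(2k)] up to a constant. Zero entropy provides at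
    most [2^k] weight patterns that approximate all the windows [xi(m), .., xi(m
    + L - 1)], so a union bound over them shows that the short sums of [xi
    kappa] are at most a small multiple of [L delta] on average. The boundary
    terms arising when windows are averaged are controlled by the second
    moments, without any pointwise bound on [kappa]. *)

(** * Even moments of weighted sums *)

(* The number of words of length [n] over [L] letters in which every letter occurs
   an even number of times; [j] is the number of occurrences of the last letter. *)
Fixpoint even_words (L n : nat) : nat :=
  (if L is L'.+1 then \sum_(j < n.+1 | ~~ odd j) 'C(n, j) * even_words L' (n - j)
   else n == 0)%N.

Lemma big_ord_even (F : nat -> nat) (k : nat) :
  (\sum_(j < k.*2.+1 | ~~ odd j) F j = \sum_(i < k.+1) F i.*2)%N.
Proof.
rewrite big_mkcond /=; elim: k => [|k IH]; first by rewrite !big_ord_recr !big_ord0.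
by rewrite doubleS 2!big_ord_recr /= IH /= negbK odd_double /= addn0 [RHS]big_ord_recr.
Qed.

Lemma leq_ffact_exp (n m : nat) : (n ^_ m <= n ^ m)%N.
Proof.
elim: m => [|m IH]; first by rewrite ffactn0.
by rewrite ffactnSr expnSr leq_mul // leq_subr.
Qed.

(** In generating functions, [even_words L k.*2] is [(2k)!] times the coefficient of [t^(2k)] in
    [cosh(t)^L]. Coefficientwise [cosh t] is dominated by [exp(t^2)], because [i! <= (2i)!], and
    [exp(L t^2)] has coefficient [L^k / k!]. The induction on [L] multiplies the series one factor
    at a time and matches the binomial expansion of [(L + 1)^k]. *)
Lemma even_words_fact (L k : nat) :
  (even_words L k.*2 * k`! <= k.*2`! * L ^ k)%N.
Proof.
elim: L k => [|L IH] k; first by case: k => [|k].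
rewrite /= (big_ord_even (fun j => 'C(k.*2, j) * even_words L (k.*2 - j))%N).
rewrite -[L.+1]addn1 expnDn !big_distrl big_distrr /=.
apply: leq_sum => i _; have ik : (i <= k)%N by rewrite -ltnS.
rewrite -doubleB exp1n muln1.
have e1 : ('C(k.*2, i.*2) * (i.*2`! * (k - i).*2`!) = k.*2`!)%N.
  by rewrite doubleB bin_fact // leq_double.
have e2 := bin_fact ik.
(* Multiplying by this factor clears the denominators of both binomials; the only loss afterwards is
   [le_i], besides the induction hypothesis. *)
have p1 : (0 < i.*2`! * (k - i)`!)%N by rewrite muln_gt0 !fact_gt0.
rewrite -(leq_pmul2r p1) -[in X in (_ * X * _ <= _)%N]e2 -[X in (_ <= X * _ * _)%N]e1.
have le_i : (i`! <= i.*2`!)%N by rewrite leq_fact // -addnn leq_addr.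
set b := 'C(k.*2, _); set b' := 'C(k, _); set W := even_words _ _.
have := IH (k - i)%N; rewrite -/W => h.
apply: (@leq_trans (b * b' * (i`! * (k - i)`! * i.*2`!) * (W * (k - i)`!))); first by nia.
apply: (@leq_trans (b * b' * (i.*2`! * (k - i)`! * i.*2`!) * ((k - i).*2`! * L ^ (k - i)))).
  by rewrite leq_mul // leq_mul // leq_mul // leq_mul.
by nia.
Qed.

Lemma even_words_le (L k : nat) : (even_words L k.*2 <= (k.*2 * L) ^ k)%N.
Proof.
rewrite -(leq_pmul2r (fact_gt0 k)) (leq_trans (even_words_fact L k)) //.
have -> : (k.*2`! = k.*2 ^_ k * k`!)%N.
  by rewrite -(@ffact_fact k.*2 k) -addnn ?leq_addr // addnK.
by rewrite expnMn mulnAC leq_mul // leq_mul // leq_ffact_exp.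
Qed.

Section MomentExpansion.
Variables (R : realFieldType) (I : Type) (r : seq I) (L0 N : nat).
Variables (x : nat -> I -> R) (c : nat -> R) (B a eta : R).

Hypothesis c_le : forall h, `|c h| <= B.

Let even_exp (nu : nat -> nat) := [forall i : 'I_L0, ~~ odd (nu i)].
Let monom (nu : nat -> nat) m := \prod_(i < L0) x i m ^+ nu i.

Hypothesis monom_le : forall nu : nat -> nat, (\sum_(i < L0) nu i = N)%N ->
  `|\sum_(m <- r) monom nu m| <= (even_exp nu)%:R * a + eta.

(** Induction on the number [L] of letters still to be expanded; [nu] records the exponents already
    chosen for the letters from [L] on. Each of the [L^n] words costs an error [eta], and the main
    term [a] is paid only by words that keep all exponents even. *)
Lemma moment_expansion (L n : nat) (nu : nat -> nat) :
  (L <= L0)%N -> (forall i, i < L -> nu i = 0)%N ->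
  (n + \sum_(i < L0) nu i = N)%N ->
  `|\sum_(m <- r) monom nu m * (\sum_(h < L) c h * x h m) ^+ n| <=
  B ^+ n * ((even_exp nu)%:R * a * (even_words L n)%:R + eta * L%:R ^+ n).
Proof.
elim: L n nu => [|L IH] n nu leL nu0 sumN.
  case: n sumN => [|n] sumN.
    rewrite expr0 mul1r mulr1 mulr1 (le_trans _ (monom_le sumN)) //.
    by rewrite le_eqVlt; under eq_bigr do rewrite big_ord0 expr0 mulr1; rewrite eqxx.
  rewrite big1 ?normr0; last by move=> m _; rewrite big_ord0 expr0n mulr0.
  have B0 : 0 <= B by rewrite (le_trans _ (c_le 0)).
  by rewrite expr0n /= !mulr0 addr0 mulr0.
have B0 : 0 <= B by rewrite (le_trans _ (c_le 0)).
(* Letter [L] is assigned exponent [j], leaving [n - j] factors for the smaller letters. *)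
pose nu' j i := if i == L then j else nu i.
have monomE j m : monom (nu' j) m = x L m ^+ j * monom nu m.
  rewrite /monom (bigD1 (Ordinal leL)) //= [in RHS](bigD1 (Ordinal leL)) //=.
  rewrite /nu' eqxx nu0 // expr0 mul1r; congr (_ * _).
  by apply: eq_bigr => i; rewrite -val_eqE /= => /negbTE ->.
have sumE j : (\sum_(i < L0) nu' j i = j + \sum_(i < L0) nu i)%N.
  rewrite (bigD1 (Ordinal leL)) //= [in RHS](bigD1 (Ordinal leL)) //=.
  rewrite /nu' eqxx (nu0 L) // add0n; congr (_ + _)%N.
  by apply: eq_bigr => i; rewrite -val_eqE /= => /negbTE ->.
have evenE j : even_exp (nu' j) = ~~ odd j && even_exp nu.
  apply/forallP/andP => [h|[jev /forallP h] i].
    split; first by have := h (Ordinal leL); rewrite /nu' eqxx.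
    apply/forallP => i; have := h i; rewrite /nu'.
    by case: eqP => // -> _; rewrite nu0.
  by rewrite /nu'; case: eqP.
have expand m : monom nu m * (\sum_(h < L.+1) c h * x h m) ^+ n =
    \sum_(j < n.+1) (c L ^+ j *+ 'C(n, j)) *
      (monom (nu' j) m * (\sum_(h < L) c h * x h m) ^+ (n - j)).
  rewrite big_ord_recr /= exprDn mulr_sumr; apply: eq_bigr => j _.
  rewrite monomE exprMn mulrnAr mulrnAl; congr (_ *+ _).
  by move: (_ ^+ (n - j)) (x L m ^+ j) (c L ^+ j) (monom nu m) => S X C p; ring.
under eq_bigr do rewrite expand.
rewrite exchange_big /= (le_trans (ler_norm_sum _ _ _)) //.
(* The binomial theorem distributes the error over [j], in parallel with the recursion defining
   [even_words]. *)
have -> : eta * L.+1%:R ^+ n = \sum_(j < n.+1) (eta * L%:R ^+ (n - j) *+ 'C(n, j)).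
  rewrite -addn1 natrD exprDn mulr_sumr; apply: eq_bigr => j _.
  by rewrite expr1n mulr1 mulrnAr.
rewrite natr_sum mulr_sumr [X in _ * (X + _)]big_mkcond /= -big_split mulr_sumr /=.
apply: ler_sum => j _; have jn : (j <= n)%N by rewrite -ltnS.
rewrite -mulr_sumr normrM normrMn normrX.
have nu'0 i : (i < L)%N -> nu' j i = 0%N.
  by move=> iL; rewrite /nu' ltn_eqF // nu0 // ltnW.
have sumN' : (n - j + \sum_(i < L0) nu' j i = N)%N by rewrite sumE addnA subnK.
have h := IH (n - j)%N (nu' j) (ltnW leL) nu'0 sumN'.
have bj : `|c L| ^+ j *+ 'C(n, j) <= B ^+ j *+ 'C(n, j).
  by rewrite lerMn2r lerXn2r ?orbT // nnegrE.
apply: le_trans (ler_pM _ _ bj h) _; rewrite ?normr_ge0 ?mulrn_wge0 ?exprn_ge0 //.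
have -> : B ^+ n = B ^+ (n - j) * B ^+ j by rewrite -exprD subnK.
rewrite evenE le_eqVlt; apply/orP; left; apply/eqP.
have -> : (~~ odd j && even_exp nu)%:R = if ~~ odd j then (even_exp nu)%:R else 0 :> R.
  by case: (odd j).
rewrite natrM -[B ^+ j *+ _]mulr_natr -[eta * _ *+ _]mulr_natr.
move: (B ^+ (n - j)) (B ^+ j) (L%:R ^+ (n - j)) ('C(n, j)%:R) (even_words L (n - j))%:R.
by move: (even_exp nu)%:R => e b1 b2 l b w; case: (odd j) => /=; ring.
Qed.
End MomentExpansion.

Lemma even_moment_le (R : realFieldType) (I : Type) (r : seq I) (L k : nat)
    (x : nat -> I -> R) (c : nat -> R) (B a eta : R) :
  0 <= a -> 0 <= eta -> (forall h, `|c h| <= B) ->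
  (forall nu : nat -> nat, (\sum_(i < L) nu i = k.*2)%N ->
    `|\sum_(m <- r) \prod_(i < L) x i m ^+ nu i| <=
      [forall i : 'I_L, ~~ odd (nu i)]%:R * a + eta) ->
  \sum_(m <- r) (\sum_(h < L) c h * x h m) ^+ k.*2 <=
  B ^+ k.*2 * (a * (k.*2 * L)%:R ^+ k + eta * L%:R ^+ k.*2).
Proof.
move=> a0 eta0 cB xP.
have B0 : 0 <= B by rewrite (le_trans _ (cB 0)).
rewrite (le_trans (ler_norm _)) //.
have := @moment_expansion R I r L k.*2 x c B a eta cB xP L k.*2 (fun=> 0%N) (leqnn _).
rewrite big1 // addn0 => /(_ (fun _ _ => erefl) erefl).
rewrite (_ : [forall _, _]) ?mul1r; last by apply/forallP.
under [X in `|X|]eq_bigr do rewrite big1 ?mul1r //.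
move=> /le_trans; apply; rewrite ler_wpM2l ?exprn_ge0 // lerD2r ler_wpM2l //.
by rewrite -natrX ler_nat even_words_le.
Qed.

(** * Moments of short sums under the Chowla-type hypothesis *)

(** Clauses of [chowla_type] demand positive exponents, so shifts of exponent 0 have to be dropped
    from the sums and products. *)
Lemma big_ord_filter (V : Type) (idx : V) (op : Monoid.law idx) (L : nat)
    (P : pred nat) (F : nat -> V) : (forall i, ~~ P i -> F i = idx) ->
  let s := [seq i <- iota 0 L | P i] in
  \big[op/idx]_(i < L) F i = \big[op/idx]_(j < size s) F (nth 0%N s j).
Proof.
move=> F1 s; have -> : \big[op/idx]_(j < size s) F (nth 0%N s j) = \big[op/idx]_(i <- s) F i.
  by rewrite (big_nth 0%N) big_mkord.
rewrite -(big_mkord xpredT F) big_filter [RHS]big_mkcond /index_iota subn0.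
by apply: eq_bigr => i _; case: ifPn => // /F1.
Qed.

Lemma cabsR (R : realType) (x : R) : cabs x%:C = `|x|.
Proof. by rewrite /cabs /= expr0n addr0 sqrtr_sqr. Qed.

Lemma cabs_ge0 (R : realType) (z : R[i]) : 0 <= cabs z.
Proof. by case: z => a b; rewrite /cabs /= sqrtr_ge0. Qed.

Section Moments.
Variables (R : realType) (kappa : nat -> R).
Local Notation K := (fun m => (kappa m)%:C).
Local Notation delta M := (abs_sum K M / M%:R).

Lemma correlationR (s : nat) (nu h : 'I_s -> nat) (M : nat) :
  correlation K nu h M =
  (M%:R^-1 * \sum_(1 <= m < M.+1) \prod_(i < s) kappa (m + h i)%N ^+ nu i)%:C.
Proof.
rewrite /correlation rmorphM /= fmorphV rmorph_nat rmorph_sum /=; congr (_ * _).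
by apply: eq_bigr => m _; rewrite rmorph_prod; apply: eq_bigr => i _; rewrite rmorphXn.
Qed.

Lemma delta_ge0 (M : nat) : 0 <= delta M.
Proof. by rewrite divr_ge0 // sumr_ge0 // => m _; rewrite cabsR. Qed.

(** Both clauses are merged into one inequality, in the shape expected by [even_moment_le]: the
    indicator of even exponents carries clause (ii), and [eta] absorbs the little-o of clause (i).
    Zero exponents are now allowed. *)
Lemma chowla_moments : chowla_type K -> exists2 A : R, 1 <= A &
  forall (L : nat) (nu : nat -> nat) (eta : R), 0 < eta ->
  let N := (\sum_(i < L) nu i)%N in
  \forall M \near \oo,
    `|\sum_(1 <= m < M.+1) \prod_(i < L) kappa (m + i)%N ^+ nu i| <=
    [forall i : 'I_L, ~~ odd (nu i)]%:R * (M%:R * (A * delta M) ^+ N) +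
    eta * (M%:R * delta M ^+ N).
Proof.
move=> [A [A1 chowla]]; exists A => // L nu eta eta0 N.
have A0 : 0 <= A by rewrite (le_trans _ A1).
have rhs_ge0 b n M : 0 <= b -> 0 <= b * (M%:R * (A * delta M) ^+ n).
  by move=> b0; rewrite !mulr_ge0 // exprn_ge0 // mulr_ge0 // delta_ge0.
have rhs2_ge0 n M : 0 <= eta * (M%:R * delta M ^+ n).
  by rewrite !mulr_ge0 ?exprn_ge0 ?delta_ge0 // ltW.
pose s := [seq i <- iota 0 L | (0 < nu i)%N].
pose h (j : 'I_(size s)) := nth 0%N s j.
have prodE m : \prod_(i < L) kappa (m + i)%N ^+ nu i =
    \prod_(j < size s) kappa (m + h j)%N ^+ nu (h j).
  apply: (@big_ord_filter _ _ _ L (fun i => 0 < nu i)%N (fun i => kappa (m + i)%N ^+ nu i)) => i.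
  by rewrite -eqn0Ngt => /eqP ->.
have NE : N = (\sum_(j < size s) nu (h j))%N.
  by apply: (@big_ord_filter _ _ _ L (fun i => 0 < nu i)%N nu) => i; rewrite -eqn0Ngt => /eqP.
have evenE : [forall i : 'I_L, ~~ odd (nu i)] = [forall j, ~~ odd (nu (h j))].
  apply/forallP/forallP => ev i.
    have /mem_nth : (i < size s)%N by [].
    move=> /(_ 0%N); rewrite mem_filter mem_iota => /and3P[_ _ iL].
    exact: (ev (Ordinal iL)).
  have [->//|nu0] := posnP (nu i).
  have si : nat_of_ord i \in s by rewrite mem_filter nu0 mem_iota /=.
  have si' : (index (nat_of_ord i) s < size s)%N by rewrite index_mem.
  by have := ev (Ordinal si'); rewrite /h /= nth_index.
(* With all exponents zero the hypothesis does not apply, but every product is 1 and the sum is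
   [M]. *)
have [s0|s0] := posnP (size s).
  have -> : N = 0%N by rewrite NE big1 // => j _; have := ltn_ord j; rewrite {2}s0.
  have -> : [forall i : 'I_L, ~~ odd (nu i)] 
    by rewrite evenE; apply/forallP => j; have := ltn_ord j; rewrite {2}s0.
  have prod1 m : \prod_(i < L) kappa (m + i)%N ^+ nu i = 1.
    by rewrite prodE big1 // => j _; have := ltn_ord j; rewrite {2}s0.
  apply: nearW => M; under eq_bigr do rewrite prod1.
  rewrite sumr_const_nat subn1 /= !expr0 ger0_norm // mulr1 mul1r lerDl.
  by rewrite mulr_ge0 // ltW.
have nu_gt0 j : (0 < nu (h j))%N.
  by have /mem_nth : (j < size s)%N by []; move=> /(_ 0%N); rewrite mem_filter => /andP[].
have h_incr (i j : 'I_(size s)) : (i < j)%N -> (h i < h j)%N.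
  move=> ij; rewrite /h (sorted_ltn_nth ltn_trans) ?inE //.
  by apply: sorted_filter; [exact: ltn_trans|exact: iota_ltn_sorted].
have [odd_case even_case] := chowla _ (nu \o h) h s0 nu_gt0 h_incr.
have corr_le M (b : R) : (0 < M)%N -> cabs (correlation K (nu \o h) h M) <= b ->
    `|\sum_(1 <= m < M.+1) \prod_(i < L) kappa (m + i)%N ^+ nu i| <= M%:R * b.
  move=> M0; rewrite correlationR cabsR normrM normfV normr_nat mulrC ler_pdivrMr ?ltr0n //.
  by under eq_bigr do rewrite -prodE; rewrite [b * _]mulrC.
rewrite evenE; have [/forallP ev|nev] := boolP [forall i, ~~ odd (nu (h i))].
  near=> M.
  rewrite mul1r ler_wpDr // NE; apply: corr_le; first by near: M; exact: nbhs_infty_gt.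
  by near: M; exact: even_case.
have /odd_case/eqoP/(_ _ eta0) small : ~ forall i, ~~ odd (nu (h i)).
  by move=> ev; move/negP: nev; apply; apply/forallP.
near=> M.
rewrite mul0r add0r mulrCA NE.
apply: corr_le; first by near: M; exact: nbhs_infty_gt.
rewrite -[leLHS]ger0_norm ?cabs_ge0 // -[X in eta * X]ger0_norm ?exprn_ge0 ?delta_ge0 //.
by near: M.
Unshelve. all: by end_near.
Qed.
End Moments.

(** * From window moments to the twisted sum *)

Section WindowMoments.
Variables (R : realType) (kappa : nat -> R) (A : R).
Local Notation K := (fun m => (kappa m)%:C).
Local Notation delta M := (abs_sum K M / M%:R).

Hypothesis A_ge1 : 1 <= A.
Hypothesis moments : forall (L : nat) (nu : nat -> nat) (eta : R), 0 < eta ->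
  let N := (\sum_(i < L) nu i)%N in
  \forall M \near \oo,
    `|\sum_(1 <= m < M.+1) \prod_(i < L) kappa (m + i)%N ^+ nu i| <=
    [forall i : 'I_L, ~~ odd (nu i)]%:R * (M%:R * (A * delta M) ^+ N) +
    eta * (M%:R * delta M ^+ N).

Let A_ge0 : 0 <= A. Proof. by rewrite (le_trans _ A_ge1). Qed.
Let A_gt0 : 0 < A. Proof. by rewrite (lt_le_trans _ A_ge1). Qed.

(** The threshold on [M] has to be uniform in the weights [c]. This is possible because the weights
    enter only after the expansion, which involves finitely many exponent vectors. *)
Lemma window_moment (L k : nat) (B : R) : (0 < L)%N -> (0 < k)%N ->
  \forall M \near \oo, forall c : nat -> R, (forall h, `|c h| <= B) ->
    \sum_(1 <= m < M.+1) (\sum_(h < L) c h * kappa (m + h)%N) ^+ k.*2 <=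
    2 * (M%:R * ((B * (A * delta M)) ^+ k.*2 * (k.*2 * L)%:R ^+ k)).
Proof.
(* There are [L^(2k)] words, so their errors add up to one [M delta^(2k)], which the main term
   dominates as [A >= 1]; hence the factor 2. *)
move=> L0 k0; pose eta : R := (L%:R ^+ k.*2)^-1.
have Lk0 : 0 < L%:R ^+ k.*2 :> R by rewrite exprn_gt0 // ltr0n.
have eta0 : 0 < eta by rewrite invr_gt0.
(* Exponents summing to [2k] are each at most [2k], so they are coded by a finite type, over which
   [filter_forall] intersects the thresholds. *)
pose ext (f : {ffun 'I_L -> 'I_k.*2.+1}) (i : nat) : nat :=
  if insub i is Some j then f j else 0%N.
have ext_ord f (j : 'I_L) : ext f j = f j by rewrite /ext valK.
have all_moments : \forall M \near \oo, forall f : {ffun 'I_L -> 'I_k.*2.+1}, _ :=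
  filter_forall eventually_filter (fun f => moments L (ext f) eta0).
apply: filterS all_moments => M mom c cB.
move: mom (delta_ge0 kappa M); move: (delta M) => d mom d0.
have a0 : 0 <= M%:R * (A * d) ^+ k.*2.
  by apply: mulr_ge0 => //; apply/exprn_ge0/mulr_ge0.
have e0 : 0 <= eta * (M%:R * d ^+ k.*2).
  by apply: mulr_ge0; [exact: ltW|apply: mulr_ge0 => //; exact: exprn_ge0].
have B0 : 0 <= B by rewrite (le_trans _ (cB 0%N)).
apply: le_trans (even_moment_le (x := fun h m => kappa (m + h)%N) a0 e0 cB _) _.
  move=> nu sum_nu.
  pose f := [ffun i : 'I_L => inord (nu i) : 'I_k.*2.+1].
  have nuE (i : 'I_L) : nu i = ext f i.
    by rewrite ext_ord ffunE inordK // ltnS -sum_nu (bigD1 i) //= leq_addr.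
  have -> : \sum_(1 <= m < M.+1) \prod_(i < L) kappa (m + i)%N ^+ nu i =
      \sum_(1 <= m < M.+1) \prod_(i < L) kappa (m + i)%N ^+ ext f i.
    by apply: eq_bigr => m _; apply: eq_bigr => i _; rewrite nuE.
  have -> : [forall i : 'I_L, ~~ odd (nu i)] = [forall i : 'I_L, ~~ odd (ext f i)].
    by apply: eq_forallb => i; rewrite nuE.
  have := mom f; rewrite (_ : (\sum_(i < L) ext f i)%N = k.*2) //.
  by rewrite -sum_nu; apply: eq_bigr => i _; rewrite nuE.
have -> : eta * (M%:R * d ^+ k.*2) * L%:R ^+ k.*2 = M%:R * d ^+ k.*2.
  by rewrite mulrAC mulVf ?mul1r // gt_eqF.
have -> : (B * (A * d)) ^+ k.*2 = B ^+ k.*2 * (A * d) ^+ k.*2 by rewrite exprMn.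
have le1 : d ^+ k.*2 <= (A * d) ^+ k.*2 * (k.*2 * L)%:R ^+ k.
  rewrite exprMn mulrAC ler_peMl ?exprn_ge0 //.
  have l1 : 1 <= (k.*2 * L)%:R ^+ k :> R.
    by rewrite exprn_ege1 // ler1n muln_gt0 double_gt0 k0.
  have a1 : 1 <= A ^+ k.*2 by rewrite exprn_ege1.
  by nra.
rewrite [leRHS](_ : _ = B ^+ k.*2 * (M%:R * (A * d) ^+ k.*2 * (k.*2 * L)%:R ^+ k
   + M%:R * ((A * d) ^+ k.*2 * (k.*2 * L)%:R ^+ k))).
  by rewrite ler_wpM2l ?exprn_ge0 // lerD2l ler_wpM2l.
by move: (B ^+ _) ((A * _) ^+ _) (_ ^+ k) => b a l; ring.
Qed.

Lemma second_moment (h : nat) : \forall M \near \oo,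
  \sum_(1 <= m < M.+1) kappa (m + h)%N ^+ 2 <= 2 * (M%:R * (A * delta M) ^+ 2).
Proof.
pose nu i := if i == h then 2%N else 0%N.
have sum_nu : (\sum_(i < h.+1) nu i = 2)%N.
  rewrite (bigD1 ord_max) //= /nu eqxx big1 // => i.
  by rewrite -val_eqE /= => /negbTE ->.
have := moments h.+1 nu ltr01; rewrite sum_nu; apply: filterS => M.
under eq_bigr => m _.
  rewrite (bigD1 ord_max) //= {1}/nu eqxx big1 ?mulr1; last first.
    by move=> i; rewrite /nu -val_eqE /= => /negbTE ->.
  over.
have -> : [forall i : 'I_h.+1, ~~ odd (nu i)].
  by apply/forallP => i; rewrite /nu; case: eqP.
move/(le_trans (ler_norm _))/le_trans; apply.
rewrite mul1r mulr2n mulrDl mul1r lerD2l mul1r ler_wpM2l // lerXn2r ?nnegrE ?delta_ge0 //.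
  by rewrite mulr_ge0 // delta_ge0.
by rewrite ler_peMl // delta_ge0.
Qed.

(** The arithmetic-geometric inequality with parameter [t = A delta] turns the second moment into a
    first moment; positivity of [delta] permits the division by [t]. *)
Lemma mean_abs_shift (h : nat) : \forall M \near \oo, 0 < delta M ->
  \sum_(1 <= m < M.+1) `|kappa (m + h)%N| <= 2 * (M%:R * (A * delta M)).
Proof.
apply: filterS (second_moment h) => M mom2 d0.
have {d0} : 0 < A * delta M by rewrite mulr_gt0.
move: (A * delta M) mom2 => t mom2 t0.
have amgm m : `|kappa (m + h)%N| <= t / 2 + kappa (m + h)%N ^+ 2 / (2 * t).
  rewrite -(real_normK (num_real (kappa _))) -subr_ge0; set s := `|_|.
  have -> : t / 2 + s ^+ 2 / (2 * t) - s = (s - t) ^+ 2 / (2 * t) by field; rewrite gt_eqF.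
  by rewrite divr_ge0 ?sqr_ge0 // mulr_ge0 // ltW.
apply: le_trans (ler_sum _ (fun m _ => amgm m)) _.
rewrite big_split /= sumr_const_nat subn1 /= -mulr_suml.
have : (\sum_(1 <= m < M.+1) kappa (m + h)%N ^+ 2) / (2 * t) <= M%:R * t.
  rewrite ler_pdivrMr ?mulr_gt0 //; apply: le_trans mom2 _.
  by rewrite le_eqVlt; apply/orP; left; apply/eqP; ring.
have : 0 <= M%:R * t by rewrite mulr_ge0 // ltW.
rewrite -[t / 2 *+ M]mulr_natl; set S := _ / (2 * t); nra.
Qed.

(** Shifting by one changes the sum by two boundary terms only, and induction on [h] accumulates
    them. *)
Lemma shift_sum (u : nat -> R) (B : R) (h : nat) (eta : R) :
  (forall m, `|u m| <= B * `|kappa m|) -> 0 < eta ->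
  \forall M \near \oo,
    `|\sum_(1 <= m < M.+1) u (m + h)%N - \sum_(1 <= m < M.+1) u m| <=
    eta * (M%:R * delta M).
Proof.
move=> uB; elim: h eta => [|h IH] eta eta0.
  apply: nearW => M; under eq_bigr do rewrite addn0.
  by rewrite subrr normr0; apply/mulr_ge0/mulr_ge0; [exact: ltW| |exact: delta_ge0].
pose B' := `|B| + 1; have B'0 : 0 < B' by rewrite ltr_wpDl.
have e4 : 0 < eta / 4 by rewrite divr_gt0.
have e2 : 0 < eta / 2 by rewrite divr_gt0.
near=> M.
have M0 : (0 < M)%N by near: M; exact: nbhs_infty_gt.
(* One square is at most the whole sum of squares, so a boundary value of [kappa] is at most
   [sqrt(2M) A delta], which is negligible against [M delta] once [M] is large. *)
have small j m : (1 <= m < M.+1)%N ->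
    \sum_(1 <= i < M.+1) kappa (i + j)%N ^+ 2 <= 2 * (M%:R * (A * delta M) ^+ 2) ->
    `|u (m + j)%N| <= eta / 4 * (M%:R * delta M).
  move=> mM mom2.
  have le2 : kappa (m + j)%N ^+ 2 <= 2 * (M%:R * (A * delta M) ^+ 2).
    apply: le_trans mom2; rewrite (bigD1_seq m) ?mem_index_iota ?iota_uniq //=.
    by rewrite lerDl sumr_ge0 // => i _; rewrite sqr_ge0.
  have big_M : 2 * (A * B') ^+ 2 <= (eta / 4) ^+ 2 * M%:R.
    rewrite [leRHS]mulrC -ler_pdivrMr ?exprn_gt0 //; near: M; exact: nbhs_infty_ger.
  have uB' : `|u (m + j)%N| <= B' * `|kappa (m + j)%N|.
    apply: le_trans (uB _) _; rewrite ler_wpM2r // /B'.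
    by rewrite (le_trans (ler_norm _)) // lerDl.
  have rhs0 : 0 <= eta / 4 * (M%:R * delta M).
    by apply/mulr_ge0/mulr_ge0; [exact: ltW| |exact: delta_ge0].
  move: le2 rhs0; move: (delta M) => d le2 rhs0.
  apply: (le_trans uB').
  rewrite -(@ler_pXn2r _ 2) ?nnegrE //; last by rewrite mulr_ge0 // ltW.
  rewrite exprMn real_normK ?num_real //.
  have step : B' ^+ 2 * kappa (m + j)%N ^+ 2 <= 2 * (A * B') ^+ 2 * (M%:R * d ^+ 2).
    apply: le_trans (ler_wpM2l (sqr_ge0 _) le2) _.
    by rewrite le_eqVlt; apply/orP; left; apply/eqP; rewrite !exprMn; ring.
  apply: (le_trans step).
  apply: le_trans (ler_wpM2r _ big_M) _; first by rewrite mulr_ge0 // sqr_ge0.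
  by rewrite le_eqVlt; apply/orP; left; apply/eqP; rewrite !exprMn; ring.
have shift1 : \sum_(1 <= m < M.+1) u (m + h.+1)%N - \sum_(1 <= m < M.+1) u (m + h)%N =
    u (M + h.+1)%N - u (1 + h)%N.
  rewrite -sumrB; under eq_bigr do rewrite addnS -addSn.
  by rewrite (telescope_sumr (fun m => u (m + h)%N)) // addSnnS.
have -> : \sum_(1 <= m < M.+1) u (m + h.+1)%N - \sum_(1 <= m < M.+1) u m =
   u (M + h.+1)%N - u (1 + h)%N + (\sum_(1 <= m < M.+1) u (m + h)%N - \sum_(1 <= m < M.+1) u m).
  by rewrite -shift1; ring.
have s1 : `|u (M + h.+1)%N| <= eta / 4 * (M%:R * delta M).
  by apply: small; [rewrite M0 ltnSn | near: M; exact: second_moment].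
have s2 : `|u (1 + h)%N| <= eta / 4 * (M%:R * delta M).
  by apply: small; [rewrite /= ltnS | near: M; exact: second_moment].
have s3 : `|\sum_(1 <= m < M.+1) u (m + h)%N - \sum_(1 <= m < M.+1) u m| <=
    eta / 2 * (M%:R * delta M) by near: M; exact: IH.
apply: le_trans (ler_normD _ _) _; have := ler_normB (u (M + h.+1)%N) (u (1 + h)%N).
by set D := M%:R * delta M in s1 s2 s3 *; lra.
Unshelve. all: by end_near.
Qed.

(** The order of quantifiers matters: [c] is chosen first, large enough that each pattern has
    normalised moment at most [2 * 4^(-k)], and only then does [patterns] return [k] and at most
    [2^k] patterns. *)
Lemma twisted_sum_small (g : nat -> R) (B : R) :
  (forall m, `|g m| <= B) ->
  (forall (eps : R) (c : nat), 0 < eps -> (0 < c)%N ->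
    exists k n (z : 'I_n -> nat -> R), [/\ (0 < k)%N, (n <= 2 ^ k)%N,
      forall i h, `|z i h| <= B &
      forall m, exists i, forall h, (h < c * k)%N -> `|g (m + h)%N - z i h| <= eps]) ->
  forall e : R, 0 < e ->
  \forall M \near \oo,
    `|\sum_(1 <= m < M.+1) g m * kappa m| <= e * abs_sum K M.
Proof.
move=> gB patterns e e0.
(* Error budget, in units of [M delta]: [theta] for replacing the sum by window averages, [2 theta]
   for the windows of the patterns, and [2 A eps = theta] for approximating [g] by patterns; in all
   [4 theta = e]. *)
pose theta := e / 4; have theta0 : 0 < theta by rewrite divr_gt0.
pose eps := e / (8 * A); have eps0 : 0 < eps by rewrite divr_gt0 // mulr_gt0.
have [c c0 c_large] : exists2 c : nat, (0 < c)%N &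
    8 * (A * B) ^+ 2 / theta ^+ 2 <= c%:R :> R.
  exists (Num.truncn (8 * (A * B) ^+ 2 / theta ^+ 2)).+1 => //.
  exact/ltW/truncnS_gt.
have [k [n [z [k0 nk zB zP]]]] := patterns eps c eps0 c0.
pose L := (c * k)%N; have L0 : (0 < L)%N by rewrite muln_gt0 c0.
have LR0 : 0 < L%:R :> R by rewrite ltr0n.
pose u m := g m * kappa m.
have uB m : `|u m| <= B * `|kappa m| by rewrite normrM ler_wpM2r.
have shifts := filter_forall eventually_filter (fun h : 'I_L => shift_sum h uB theta0).
have means := filter_forall eventually_filter (fun h : 'I_L => mean_abs_shift h).
near=> M.
have M0 : (0 < M)%N by near: M; exact: nbhs_infty_gt.
have MR0 : 0 < M%:R :> R by rewrite ltr0n.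
have DE : abs_sum K M = M%:R * delta M by rewrite mulrC divfK // gt_eqF.
(* If [delta] vanishes, so does every [kappa m] in the range; otherwise the threshold [tau] below is
   positive and can be divided by. *)
have [d0|d0] := eqVneq (delta M) 0.
  rewrite DE d0 !mulr0 (le_trans (ler_norm_sum _ _ _)) //.
  apply: le_trans (ler_sum _ (fun m _ => uB m)) _.
  have -> : \sum_(1 <= m < M.+1) B * `|kappa m| = B * abs_sum K M.
    by rewrite mulr_sumr; apply: eq_bigr => m _; rewrite cabsR.
  by rewrite DE d0 !mulr0.
have {}d0 : 0 < delta M by rewrite lt_neqAle eq_sym d0 delta_ge0.
have shiftM : forall h : 'I_L, `|\sum_(1 <= m < M.+1) u (m + h)%N -
    \sum_(1 <= m < M.+1) u m| <= theta * (M%:R * delta M) by near: M.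
have meanM : forall h : 'I_L,
    \sum_(1 <= m < M.+1) `|kappa (m + h)%N| <= 2 * (M%:R * (A * delta M)).
  by move=> h; move: h d0; near: M.
have momM : forall w : nat -> R, (forall h, `|w h| <= B) ->
    \sum_(1 <= m < M.+1) (\sum_(h < L) w h * kappa (m + h)%N) ^+ k.*2 <=
    2 * (M%:R * ((B * (A * delta M)) ^+ k.*2 * (k.*2 * L)%:R ^+ k)).
  by near: M; exact: window_moment.
rewrite DE; move: (delta M) d0 shiftM meanM momM => d d0 shiftM meanM momM.
pose S i m := \sum_(h < L) z i h * kappa (m + h)%N.
pose tau := theta * (L%:R * d); have tau0 : 0 < tau by rewrite !mulr_gt0.
(* A substitute for Hölder's inequality, which lets a sum over the patterns replace
   their maximum. *)
have le_tau (t : R) : `|t| <= tau * (1 + (t / tau) ^+ k.*2).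
  have -> : `|t| = tau * `|t / tau|.
    by rewrite normf_div (gtr0_norm tau0) mulrC divfK // gt_eqF.
  have -> : (t / tau) ^+ k.*2 = `|t / tau| ^+ k.*2.
    by rewrite -mul2n !exprM real_normK ?num_real.
  rewrite ler_pM2l //; have : 0 <= `|t / tau| by [].
  move: `|t / tau| => s s0.
  have [s1|/ltW s1] := leP s 1; first by rewrite ler_wpDr // exprn_ge0.
  rewrite ler_wpDl // -{1}[s]expr1 ler_weXn2l //.
  by rewrite double_gt0.
(* The pattern fitting the window at [m] depends on [m]; adding the even powers of all other
   patterns, which are nonnegative, removes this dependence. *)
have window m : `|\sum_(h < L) u (m + h)%N| <=
    tau * (1 + \sum_i (S i m / tau) ^+ k.*2) + eps * \sum_(h < L) `|kappa (m + h)%N|.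
  have [i zi] := zP m.
  have -> : \sum_(h < L) u (m + h)%N =
      S i m + \sum_(h < L) (g (m + h)%N - z i h) * kappa (m + h)%N.
    by rewrite -big_split /=; apply: eq_bigr => h _; rewrite -mulrDl addrC subrK.
  rewrite (le_trans (ler_normD _ _)) // lerD //.
    rewrite (le_trans (le_tau _)) // ler_pM2l // lerD2l (bigD1 i) //= lerDl.
    by rewrite sumr_ge0 // => j _; rewrite -mul2n exprM exprn_ge0 // sqr_ge0.
  rewrite (le_trans (ler_norm_sum _ _ _)) // mulr_sumr ler_sum // => h _.
  by rewrite normrM ler_wpM2r // zi.
have moment_i (i : 'I_n) : \sum_(1 <= m < M.+1) (S i m / tau) ^+ k.*2 <=
    M%:R * (2 * (1 / 4) ^+ k).
  under eq_bigr do rewrite exprMn exprVn.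
  rewrite -mulr_suml ler_pdivrMr ?exprn_gt0 // (le_trans (momM _ (zB i))) //.
  rewrite mulrCA -[leRHS]mulrA ler_pM2l // -[leRHS]mulrA ler_pM2l //.
  (* Both sides are [k]-th powers, so it suffices to compare bases: [(B A d)^2 * 2 k L] against
     [tau^2 / 4]. As [L = c k], this is the choice of [c]. *)
  rewrite -!mul2n !exprM -!exprMn lerXn2r ?nnegrE //.
  - by rewrite mulr_ge0 // sqr_ge0.
  - by rewrite mulr_ge0 // sqr_ge0.
  have -> : (2 * k * L)%:R = 2 * k%:R * L%:R :> R by rewrite !natrM.
  have LE : L%:R = c%:R * k%:R :> R by rewrite natrM.
  have cl : 8 * (A * B) ^+ 2 <= c%:R * theta ^+ 2 by rewrite -ler_pdivrMr // exprn_gt0.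
  rewrite /tau; have -> : (B * (A * d)) ^+ 2 * (2 * k%:R * L%:R) =
      (8 * (A * B) ^+ 2) * (d ^+ 2 * k%:R * L%:R / 4) by field.
  have -> : 1 / 4 * (theta * (L%:R * d)) ^+ 2 =
      (c%:R * theta ^+ 2) * (d ^+ 2 * k%:R * L%:R / 4) by rewrite LE; field.
  by rewrite ler_wpM2r // divr_ge0 // !mulr_ge0 // ltW.
(* The union bound: [2^k * 2 * 4^(-k) <= 1] because [k >= 1]. *)
have sum_moments : \sum_(i < n) \sum_(1 <= m < M.+1) (S i m / tau) ^+ k.*2 <= M%:R.
  apply: le_trans (ler_sum _ (fun i _ => moment_i i)) _.
  rewrite sumr_const card_ord -mulrnAr ler_piMr // -[leLHS]mulr_natr.
  have n2 : n%:R <= 2 ^+ k :> R by rewrite -natrX ler_nat.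
  have k2 : 2 <= 2 ^+ k :> R by rewrite -{1}[2]expr1 ler_weXn2l // ler1n.
  have e4 : (1 / 4) ^+ k = ((2 ^+ k) ^+ 2)^-1 :> R.
    by rewrite mul1r exprVn -exprM mulnC exprM; congr (_ ^+ k)^-1; ring.
  have k2' : 0 < (2 ^+ k) ^+ 2 :> R by rewrite !exprn_gt0.
  rewrite e4 mulrAC ler_pdivrMr // mul1r; move: (2 ^+ k) k2 n2 {e4 k2'} => y; nra.
have total : `|\sum_(1 <= m < M.+1) \sum_(h < L) u (m + h)%N| <=
    2 * M%:R * tau + eps * (L%:R * (2 * (M%:R * (A * d)))).
  rewrite (le_trans (ler_norm_sum _ _ _)) //.
  apply: le_trans (ler_sum _ (fun m _ => window m)) _.
  rewrite big_split /= -!mulr_sumr big_split /= sumr_const_nat subn1 /=.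
  rewrite exchange_big /= [X in eps * X]exchange_big /=.
  apply: lerD.
    by rewrite [leRHS]mulrC ler_pM2l // mulr_natl mulr2n lerD2l.
  rewrite ler_pM2l // (le_trans (ler_sum _ (fun h _ => meanM h))) //.
  by rewrite sumr_const card_ord [leRHS]mulr_natl.
have avg : `|L%:R * \sum_(1 <= m < M.+1) u m - \sum_(1 <= m < M.+1) \sum_(h < L) u (m + h)%N| <=
    L%:R * (theta * (M%:R * d)).
  rewrite exchange_big /= [L%:R * \sum_(_ <= _ < _) _]mulr_natl.
  rewrite -[X in _ *+ X]card_ord -sumr_const -sumrB.
  rewrite (le_trans (ler_norm_sum _ _ _)) // mulr_natl -[X in _ *+ X]card_ord -sumr_const.
  by apply: ler_sum => h _; rewrite distrC.
rewrite -(ler_pM2l LR0) -[X in X * `|_|]gtr0_norm // -normrM.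
have epsE : eps * (2 * A) = theta by rewrite /eps /theta; field; rewrite gt_eqF.
apply: (@le_trans _ _ (L%:R * (theta * (M%:R * d)) +
   (2 * M%:R * tau + eps * (L%:R * (2 * (M%:R * (A * d))))))).
  rewrite -[X in `|X|](subrK (\sum_(1 <= m < M.+1) \sum_(h < L) u (m + h)%N)).
  by rewrite (le_trans (ler_normD _ _)) // lerD.
have -> : eps * (L%:R * (2 * (M%:R * (A * d)))) = eps * (2 * A) * (L%:R * (M%:R * d)) by ring.
by rewrite epsE /tau /theta le_eqVlt; apply/orP; left; apply/eqP; field.
Unshelve. all: by end_near.
Qed.
End WindowMoments.

(** * Patterns of a zero-entropy system *)

Section Entropy.
Variables (R : realType) (X : metricType R) (T : X -> X).

Lemma bowen_dist_sym (n : nat) (x y : X) : bowen_dist T n x y = bowen_dist T n y x.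
Proof. by apply: eq_bigr => k _; rewrite metric_sym. Qed.

Lemma bowen_distxx (n : nat) (x : X) : bowen_dist T n x x = 0.
Proof.
rewrite /bowen_dist; elim/big_ind: _ => // [a b -> ->|k _]; first by rewrite maxxx.
exact: mdistxx.
Qed.

Lemma mdist_le_bowen (n k : nat) (x y : X) : (k < n)%N ->
  mdist (iter k T x) (iter k T y) <= bowen_dist T n x y.
Proof. by move=> kn; exact: (le_bigmax _ _ (Ordinal kn)). Qed.

Lemma sep_card_ge (n : nat) (e : R) (S : {fset X}) : Defs.separated T n e S ->
  ((#|` S|%:R)%:E <= sep_card T n e)%E.
Proof. by move=> sepS; apply: ereal_sup_ubound; exists S. Qed.

Lemma sep_card_ge0 (n : nat) (e : R) : (0 <= sep_card T n e)%E.
Proof. by rewrite (le_trans _ (@sep_card_ge n e fset0 _)) // => x y; rewrite inE. Qed.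

Lemma entropy_at_antitone (e e' : R) : e <= e' -> (entropy_at T e' <= entropy_at T e)%E.
Proof.
move=> ee'; apply: le_ereal_inf_tmp => _ [V VF <-].
apply: (@le_trans _ _ (ereal_sup [set (n%:R^-1%:E * lne (sep_card T n e'))%E | n in V])).
  by apply: ereal_inf_lbound; exists V.
apply: ge_ereal_sup => _ [n Vn <-].
apply: (@le_trans _ _ (n%:R^-1%:E * lne (sep_card T n e))%E); last first.
  by apply: ereal_sup_ubound; exists n.
apply: lee_wpmul2l; first by rewrite lee_fin invr_ge0.
rewrite lee_lne ?in_itv /= ?sep_card_ge0 ?leey //.
apply: ge_ereal_sup => _ [S sepS <-]; apply: sep_card_ge => x y xS yS xy.
exact: le_trans ee' (sepS x y xS yS xy).
Qed.

(** By monotonicity the limit at [0^'+] is the supremum over all positive scales. *)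
Lemma entropy_at_le_top (e : R) : 0 < e -> (entropy_at T e <= top_entropy T)%E.
Proof.
move=> e0; have cvgE : entropy_at T e' @[e' --> 0^'+] -->
    ereal_sup [set entropy_at T e' | e' in [set` Interval (BRight 0) +oo%O]].
  apply: nonincreasing_at_right_cvge => // x y _ _; exact: entropy_at_antitone.
rewrite /top_entropy (cvg_lim _ cvgE) //.
by apply: ereal_sup_ubound; exists e => //=; rewrite in_itv /= e0.
Qed.

(** A separated set of maximal cardinality is a net: a point at distance at least [e] from all its
    members could be added to it. *)
Lemma maximal_separated_cover (n N : nat) (e : R) : 0 < e ->
  (forall S : {fset X}, Defs.separated T n e S -> (#|` S| <= N)%N) ->
  exists2 S : {fset X}, (#|` S| <= N)%N &
    forall y, exists2 z, z \in S & bowen_dist T n y z < e.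
Proof.
move=> e0 sepN; pose P m := `[< exists2 S : {fset X}, Defs.separated T n e S & #|` S| = m >].
have P0 : exists m, P m.
  by exists 0%N; apply/asboolP; exists fset0; rewrite ?cardfs0 // => x y; rewrite inE.
have PN m : P m -> (m <= N)%N by move=> /asboolP[S /sepN + <-].
have [m /asboolP[S sepS cardS] maxS] := ex_maxnP P0 PN.
exists S => [|y]; first exact: sepN.
have [//|far] := pselect (exists2 z, z \in S & bowen_dist T n y z < e).
have yfar z : z \in S -> e <= bowen_dist T n y z.
  by move=> zS; rewrite leNgt; apply/negP => yz; apply: far; exists z.
have yS : y \notin S by apply/negP => /yfar; rewrite bowen_distxx leNgt e0.
have /maxS : P m.+1.
  apply/asboolP; exists (y |` S)%fset; last by rewrite cardfsU1 yS cardS.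
  move=> a b; rewrite !in_fset1U => /orP[/eqP->|aS] /orP[/eqP->|bS].
  - by rewrite eqxx.
  - by move=> _; exact: yfar.
  - by move=> _; rewrite bowen_dist_sym; exact: yfar.
  - exact: sepS.
by rewrite ltnn.
Qed.

Lemma zero_entropy_cover (e : R) (c : nat) : top_entropy T = 0%E -> 0 < e -> (0 < c)%N ->
  exists k (S : {fset X}), [/\ (0 < k)%N, (#|` S| <= 2 ^ k)%N &
    forall y, exists2 z, z \in S & bowen_dist T (c * k) y z < e].
Proof.
move=> T0 e0 c0; have ln2 : 0 < ln 2 / c%:R :> R by rewrite divr_gt0 ?ltr0n // ln_gt0 // ltr1n.
have : (entropy_at T e < (ln 2 / c%:R)%:E)%E.
  by rewrite (le_lt_trans (entropy_at_le_top e0)) // T0 lte_fin.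
(* The upper limit is an infimum of suprema over sets [V] containing all [n >= n0]. Any positive [k]
   with [c k >= n0] will do, and there [log s(c k, e) < c k * (ln 2 / c) = k ln 2]. *)
move=> /ereal_inf_lt[_ [V [n0 _ n0V] <-] supV].
pose k := n0.+1.
have Vk : V (c * k)%N by apply: n0V => /=; rewrite (leq_trans (leqnSn n0)) // leq_pmull.
have k0 : 0 < k%:R :> R by rewrite ltr0n.
have cR0 : 0 < c%:R :> R by rewrite ltr0n.
have sepk S : Defs.separated T (c * k) e S -> (#|` S| <= 2 ^ k)%N.
  move=> sepS; rewrite leqNgt; apply/negP => S2k.
  have : (((c * k)%:R)^-1%:E * lne (sep_card T (c * k) e) < (ln 2 / c%:R)%:E)%E.
    by apply: le_lt_trans supV; apply: ereal_sup_ubound; exists (c * k)%N.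
  rewrite ltNge => /negP; apply.
  apply: (@le_trans _ _ ((c * k)%:R^-1%:E * lne ((2 ^+ k)%:E))%E).
    rewrite lne_EFin ?exprn_gt0 // lnXn // -EFinM lee_fin -mulr_natr natrM.
    by rewrite le_eqVlt; apply/orP; left; apply/eqP; field; rewrite !gt_eqF.
  apply: lee_wpmul2l; first by rewrite lee_fin invr_ge0.
  rewrite lee_lne ?in_itv /= ?sep_card_ge0 ?leey ?lee_fin ?exprn_ge0 //.
  apply: le_trans (sep_card_ge sepS).
  by rewrite lee_fin -natrX ler_nat ltnW.
by have [S S2 cover] := maximal_separated_cover e0 sepk; exists k, S.
Qed.

(** * Uniform continuity and boundedness of the observable *)

Hypothesis X_compact : compact [set: X].
Variable f : X -> R[i]^o.
Hypothesis f_cont : continuous f.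

Lemma normcE (z : R[i]) : `|z| = (cabs z)%:C.
Proof. by rewrite normc_def; case: z. Qed.

Lemma cabsD (z w : R[i]) : cabs (z + w) <= cabs z + cabs w.
Proof. by rewrite -lecR rmorphD /= -!normcE ler_normD. Qed.

Lemma cabsB (z w : R[i]) : cabs (z - w) = cabs (w - z).
Proof. by apply: complexI; rewrite -!normcE distrC. Qed.

Lemma near_cabs_lt (x : X) (eps : R) : 0 < eps ->
  exists2 r : R, 0 < r & forall y, mdist x y < r -> cabs (f x - f y) < eps.
Proof.
move=> eps0; have epsC : 0 < eps%:C :> R[i] by rewrite ltcR.
have /cvgr_dist_lt/(_ _ epsC)/nbhs_ballP[r /= r0 ball_r] := @f_cont x.
exists r => // y xy; rewrite -ltcR -normcE; apply: ball_r.
by rewrite ballEmdist.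
Qed.

Lemma cabs_uniformly_continuous (eps : R) : 0 < eps ->
  exists2 e : R, 0 < e & forall y z, mdist y z < e -> cabs (f y - f z) < eps.
Proof.
move=> eps0.
pose P (e : R) y := forall z, mdist y z < e -> cabs (f y - f z) < eps.
have uniform_P : \forall e \near (0 : R)^'+, [set: X] `<=` P e.
  (* Compactness in near-covering form: a scale [e] valid for all points near each [x] is valid on
     the whole space. Halving [r] keeps both [y] and [z] within [r] of [x]. *)
  apply: ((compact_near_coveringP _).1 X_compact) => x _.
  have [r r0 fr] := near_cabs_lt x (divr_gt0 eps0 (ltr0n R 2)).
  near=> y e => z yz.
  have xy : mdist x y < r / 2.
    suff : ball x (r / 2) y by rewrite ballEmdist.
    by near: y; apply: nbhsx_ballx; rewrite divr_gt0.
  have er : e < r / 2 by near: e; apply: nbhs_right_lt; rewrite divr_gt0.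
  have xz : mdist x z < r.
    by rewrite (le_lt_trans (metric_triangle x y z)) // [r]splitr ltrD // (lt_trans yz).
  have xy' : mdist x y < r by rewrite (lt_trans xy) // ltr_pdivrMr // ltr_pMr // ltr1n.
  have -> : f y - f z = (f y - f x) + (f x - f z) by rewrite addrA subrK.
  rewrite (le_lt_trans (cabsD _ _)) // [eps]splitr ltrD ?fr //.
  by rewrite cabsB fr.
near (0 : R)^'+ => e.
exists e => // y; have : [set: X] `<=` P e by near: e.
exact.
Unshelve. all: by end_near.
Qed.

Lemma cabs_bounded : exists B : R, forall y, cabs (f y) <= B.
Proof.
pose P (n : nat) y := cabs (f y) <= n%:R.
suff : \forall n \near \oo, [set: X] `<=` P n.
  by case=> n _ /(_ n (leqnn n)) fn; exists n%:R => y; exact: fn.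
apply: ((compact_near_coveringP _).1 X_compact) => x _.
have [r r0 fr] := near_cabs_lt x ltr01.
near=> y n; rewrite /P.
have fxn : 1 + cabs (f x) <= n%:R by near: n; exact: nbhs_infty_ger.
have xy : mdist x y < r.
  suff : ball x r y by rewrite ballEmdist.
  by near: y; exact: nbhsx_ballx.
have -> : f y = (f y - f x) + f x by rewrite subrK.
rewrite (le_trans (cabsD _ _)) // (le_trans _ fxn) //.
by rewrite lerD2r cabsB ltW // fr.
Unshelve. all: by end_near.
Qed.
End Entropy.

(** * Orthogonality to deterministic sequences *)

Lemma chowla_orthogonal (R : realType) (kappa : nat -> R) (xi : nat -> R[i]) :
  chowla_type (fun m => (kappa m)%:C) -> deterministic xi ->
  (fun M => cabs (twisted_sum xi (fun m => (kappa m)%:C) M))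
    =o_\oo (fun M => abs_sum (fun m => (kappa m)%:C) M).
Proof.
move=> /chowla_moments[A A1 moments] [X [T [f [x [Xc _ T0 fc xiE]]]]].
have [B fB] := cabs_bounded Xc fc.
(* [p] will be the real or the imaginary part, so that the moment argument is only needed for real
   weights. The patterns are read along the orbits of the points of a finite net. *)
have component (p : R[i] -> R) : (forall z, `|p z| <= cabs z) ->
    (forall z w, p (z - w) = p z - p w) ->
    forall e, 0 < e -> \forall M \near \oo,
    `|\sum_(1 <= m < M.+1) p (f (iter m T x)) * kappa m| <=
    e * abs_sum (fun m => (kappa m)%:C) M.
  move=> p_le pB; apply: (twisted_sum_small A1 moments (B := B)).
    by move=> m; rewrite (le_trans (p_le _)).
  move=> eps c eps0 c0.
  have [e e0 fe] := cabs_uniformly_continuous Xc fc eps0.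
  have [k [S [k0 S2 cover]]] := zero_entropy_cover T0 e0 c0.
  exists k, #|` S|, (fun i h => p (f (iter h T (nth x S i)))); split => //.
    by move=> i h; rewrite (le_trans (p_le _)).
  move=> m; have [z zS zm] := cover (iter m T x).
  have iS : (index z S < #|` S|)%N by rewrite index_mem.
  exists (Ordinal iS) => h hck /=; rewrite nth_index //.
  (* The window of the orbit at [m] is the initial window of [iter m T x], which stays [e]-close to
     that of the net point [z]. *)
  rewrite -pB (le_trans (p_le _)) // ltW // fe // addnC iterD.
  exact: le_lt_trans (mdist_le_bowen _ _ _ hck) zm.
pose tw M := twisted_sum xi (fun m => (kappa m)%:C) M.
have ReE M : complex.Re (tw M) = \sum_(1 <= m < M.+1) complex.Re (f (iter m T x)) * kappa m.
  rewrite /tw /twisted_sum (raddf_sum (@complex.Re R)) /=; apply: eq_big_nat => m /andP[m0 _].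
  by rewrite xiE //; case: (f _) => u v /=; rewrite mulr0 subr0.
have ImE M : complex.Im (tw M) = \sum_(1 <= m < M.+1) complex.Im (f (iter m T x)) * kappa m.
  rewrite /tw /twisted_sum (raddf_sum (@complex.Im R)) /=; apply: eq_big_nat => m /andP[m0 _].
  by rewrite xiE //; case: (f _) => u v /=; rewrite mulr0 add0r.
have Re_le (z : R[i]) : `|complex.Re z| <= cabs z.
  case: z => u v; rewrite /cabs /= -sqrtr_sqr ler_wsqrtr // lerDl sqr_ge0 //.
have Im_le (z : R[i]) : `|complex.Im z| <= cabs z.
  case: z => u v; rewrite /cabs /= -sqrtr_sqr ler_wsqrtr // lerDr sqr_ge0 //.
apply/eqoP => eps eps0; have e2 : 0 < eps / 2 by rewrite divr_gt0.
near=> M.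
rewrite !ger0_norm ?cabs_ge0 ?sumr_ge0 // => [|m _]; last exact: cabs_ge0.
have -> : twisted_sum xi (fun m => (kappa m)%:C) M =
    (complex.Re (tw M))%:C + 'i * (complex.Im (tw M))%:C.
  exact: complexE.
rewrite (le_trans (cabsD _ _)) // [eps]splitr mulrDl lerD //.
  rewrite cabsR ReE; near: M; apply: (component (@complex.Re R)) => //.
  by move=> [u v] [u' v'].
rewrite /cabs Normc.normcM -![Normc.normc _]/(cabs _) cabsR ImE.
have -> : cabs 'i = 1 :> R by rewrite /cabs /= expr0n expr1n add0r sqrtr1.
rewrite mul1r; near: M; apply: (component (@complex.Im R)) => //.
by move=> [u v] [u' v'].
Unshelve. all: by end_near.
Qed.

(** * Kloosterman sums are real *)

Section Realness.
Variable R : realType.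

Lemma sin_int_sub (n : int) (t : R) : sin (2 * pi * (n%:~R - t)) = - sin (2 * pi * t).
Proof.
rewrite -sinN; have -> : 2 * pi * (n%:~R - t) = - (2 * pi * t) + (pi *+ 2) *~ n.
  by rewrite -[_ *~ n]mulrzr; ring.
case: n => n; first exact: (periodicn (sinD2pi (R := R))).
by rewrite NegzE mulrNz -[LHS](periodicn (sinD2pi (R := R)) n.+1) subrK.
Qed.

Lemma inv_modP (m : nat) (x : 'I_m) : coprime x m ->
  (x * inv_mod x = 1 %[mod m])%N.
Proof.
case: m x => [[]//|m] x co; rewrite /inv_mod; case: pickP => [y /eqP//|none].
have := none (Zp_inv x).
have : val (Zp_mul (Zp_inv x) x) = val (Zp1 : 'I_m.+1) by rewrite Zp_mulVz // coprime_sym.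
by rewrite /= mulnC => ->; rewrite eqxx.
Qed.

Lemma mod_inverse_uniq (m x y z : nat) :
  (x * y = 1 %[mod m])%N -> (x * z = 1 %[mod m])%N -> (y = z %[mod m])%N.
Proof.
move=> xy xz; have -> : (y = y * (x * z) %[mod m])%N by rewrite -modnMmr xz modnMmr muln1.
by rewrite mulnA [(y * x)%N]mulnC -modnMml xy modnMml mul1n.
Qed.

Lemma coprime_Zp_opp (m : nat) (x : 'I_m) : coprime (Zp_opp x) m = coprime x m.
Proof.
rewrite /= coprime_modl; move: (nat_of_ord x) (ltnW (ltn_ord x)) => y ym.
have [z ->] : exists z, m = (z + y)%N by exists (m - y)%N; rewrite subnK.
by rewrite addnK /coprime gcdnDl gcdnDr gcdnC.
Qed.

Lemma inv_mod_opp (m : nat) (x : 'I_m) : coprime x m ->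
  inv_mod (Zp_opp x) = Zp_opp (inv_mod x).
Proof.
move=> co; apply: val_inj => /=.
rewrite -[LHS](modn_small (ltn_ord _)); apply: (@mod_inverse_uniq m (Zp_opp x)).
  by apply: inv_modP; rewrite coprime_Zp_opp.
rewrite -(inv_modP co) /= modnMml.
set y := inv_mod x; have xm : (x <= m)%N by rewrite ltnW.
have ym : (y <= m)%N by rewrite ltnW.
(* Without truncation, [(x + y) m + (m - x)(m - y) = m m + x y]. *)
rewrite -(modnMDl (x + y)) -[RHS](modnMDl m); congr (_ %% _)%N.
nia.
Qed.

Lemma Zp_oppK (m : nat) : involutive (@Zp_opp m).
Proof. by case: m => [[]//|m] x; exact: (opprK (x : 'I_m.+1)). Qed.

(** The multiple [b] is 0 when [x] is 0, whose opposite is 0 and not [m], and 1 otherwise. *)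
Lemma Zp_opp_natr (m : nat) (x : 'I_m) :
  exists b : int, (Zp_opp x)%:R = b%:~R * m%:R - x%:R :> R.
Proof.
have [x0|x0] := posnP x.
  by exists 0; rewrite /= x0 subn0 modnn mul0r subr0.
have mx : (m - x < m)%N by rewrite ltn_subrL x0 (leq_ltn_trans _ (ltn_ord x)).
by exists 1; rewrite /= (modn_small mx) mul1r natrB // ltnW.
Qed.

Lemma kloosterman_real (a : int) (m : nat) :
  kloosterman R a m = (complex.Re (kloosterman R a m))%:C.
Proof.
(* The involution [x |-> - x] flips the sign of the imaginary part of each term. *)
pose ang (x : 'I_m) : R := (a%:~R * x%:R + (inv_mod x)%:R) / m%:R.
have sin_sum0 : \sum_(x < m | coprime x m) sin (2 * pi * ang x) = 0.
  apply/eqP; rewrite -eqNr eq_sym; apply/eqP.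
  rewrite [LHS](reindex_inj (inv_inj (@Zp_oppK m))) /=.
  rewrite -sumrN; apply: eq_big => [x|x co]; first exact: coprime_Zp_opp.
  move: co; rewrite -/(coprime (Zp_opp x) m) coprime_Zp_opp => co.
  have m0 : m%:R != 0 :> R by rewrite pnatr_eq0 -lt0n (leq_ltn_trans _ (ltn_ord x)).
  rewrite /ang inv_mod_opp //.
  have [b ->] := Zp_opp_natr x; have [b' ->] := Zp_opp_natr (inv_mod x).
  (* The angle at the opposite of [x] is the integer [a b + b'] minus the angle at [x]. *)
  rewrite -(sin_int_sub (a * b + b')) intrD intrM; congr (sin (_ * _)).
  by field.
have im0 : complex.Im (\sum_(x < m | coprime x m) e2pi (ang x)) = 0.
  by rewrite (raddf_sum (@complex.Im R)).
have sumE : \sum_(x < m | coprime x m) e2pi (ang x) =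
    (complex.Re (\sum_(x < m | coprime x m) e2pi (ang x)))%:C.
  by move: im0; case: (\sum_(x < m | coprime x m) _) => u v /= ->.
have klE : kloosterman R a m = ((Num.sqrt m%:R)^-1 *
    complex.Re (\sum_(x < m | coprime x m) e2pi (ang x)))%:C.
  by rewrite rmorphM /= -sumE.
by rewrite klE.
Qed.
End Realness.

Theorem theorem2p4 (R : realType) (a : int) (a_neq0 : a != 0) :
  (chowla_type (kloosterman_star R a) ->
   forall xi : nat -> R[i], deterministic xi ->
     (fun M : nat => cabs (twisted_sum xi (kloosterman_star R a) M))
       =o_\oo (fun M : nat => abs_sum (kloosterman_star R a) M))
  /\
  (chowla_type (kloosterman_signed_star R a) ->
   forall xi : nat -> R[i], deterministic xi ->
     (fun M : nat => cabs (twisted_sum xi (kloosterman_signed_star R a) M))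
       =o_\oo (fun M : nat => abs_sum (kloosterman_signed_star R a) M)).
Proof.
(* [kloosterman_star] is a real sequence by definition; the signed variant is one by
   [kloosterman_real]. *)
split=> chowla xi xi_det; first exact: chowla_orthogonal chowla xi_det.
have signedE : kloosterman_signed_star R a =
    fun m => (complex.Re (kloosterman R a m) / 2 ^+ omega m)%:C.
  apply/funext => m; rewrite /kloosterman_signed_star kloosterman_real.
  by rewrite rmorphM fmorphV rmorphXn /= rmorph_nat.
by rewrite signedE in chowla *; exact: chowla_orthogonal chowla xi_det.
Qed.
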